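(* For every integer $C\geq1$ there exists $r_0$ such that for every integer $r\geq r_0$ there exist trees $T$ and $\mathcal{T}$ such that: (1) $\Delta(T),\Delta(\mathcal{T})\leq 3^{C+1}$; (2) $T$ has bipartition class sizes $(3^C+1)r$ and $(3^C-1)r+(3^C-1)/2$; (3) $\mathcal{T}$ has bipartition class sizes $(3^C+1)r$ and $2r-(3^C-1)/2$; (4) $R(T,\mathcal{T})\geq 2(3^C+1)r+C-1=\underline{R}(T,\mathcal{T})+C$.
   Context: For graphs $G_1,G_2$, $R(G_1,G_2)$ is the smallest positive integer $N$ such that every red/blue colouring of the edges of $K_N$ contains a red copy of $G_1$ or a blue copy of $G_2$. For an $n$-vertex tree $T$ with bipartition class sizes $t_1\geq t_2$ and a $\nu$-vertex tree $\mathcal{T}$ with bipartition class sizes $\tau_1\geq\tau_2$, where $n\geq\nu$, define $\underline{R}(T,\mathcal{T})=\max\{n+\tau_2,\nu+\min\{t_2,\nu\},\min\{2t_1,2\nu\},2\tau_1\}-1$. $\Delta$ denotes maximum degree. *)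

(* Defs.v *)
From mathcomp Require Import all_boot.
Set Implicit Arguments.
Unset Strict Implicit.
Unset Printing Implicit Defensive.

(* Finite simple graphs. *)
Record sgraph := SGraph {
  vert :> finType;
  adj : rel vert;
  adj_sym : symmetric adj;
  adj_irrefl : irreflexive adj }.

(* The bound on the size matters: the two ends of an edge form a
   [ucycle] of size 2. *)
Definition is_tree (G : sgraph) : Prop :=
  [/\ 0 < #|G|,
      forall x y : G, connect (@adj G) x y
    & forall c : seq G, ucycle (@adj G) c -> size c <= 2].

Definition max_degree (G : sgraph) : nat :=
  \max_(x : G) #|[set y : G | adj x y]|.

Definition bip_class (G : sgraph) (A : {set G}) : bool :=
  [forall x : G, forall y : G, adj x y ==> ((x \in A) != (y \in A))].

Definition has_class_sizes (G : sgraph) (a b : nat) : Prop :=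
  exists A : {set G}, [/\ bip_class A, #|A| = a & #|~: A| = b].

(* A tree has exactly two sets satisfying [bip_class], complements of each
   other, so on trees these are the two class sizes. *)
Definition larger_class (G : sgraph) : nat :=
  \max_(A : {set G} | bip_class A) #|A|.
Definition smaller_class (G : sgraph) : nat := #|G| - larger_class G.

(* A red/blue colouring of the edges of K_N is a map on {set 'I_N}; only its
   values on pairs matter, since copies are injective and graphs are
   loopless. [true] is red and [false] is blue. *)
Definition mono_copy (N : nat) (c : {ffun {set 'I_N} -> bool}) (col : bool)
    (G : sgraph) : bool :=
  [exists f : {ffun G -> 'I_N}, injectiveb f &&
    [forall x : G, forall y : G, adj x y ==> (c [set f x; f y] == col)]].

Definition arrows (G1 G2 : sgraph) (N : nat) : bool :=
  (0 < N) && [forall c : {ffun {set 'I_N} -> bool},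
                mono_copy c true G1 || mono_copy c false G2].

Definition mono_clique (V : finType) (c : {set V} -> bool) (col : bool)
    (B : {set V}) : Prop :=
  forall x y, x \in B -> y \in B -> x != y -> c [set x; y] = col.

Lemma ramsey_clique (s t : nat) : exists N, forall (V : finType)
    (c : {set V} -> bool) (A : {set V}), N <= #|A| ->
  (exists B : {set V}, [/\ B \subset A, #|B| = s & mono_clique c true B]) \/
  (exists B : {set V}, [/\ B \subset A, #|B| = t & mono_clique c false B]).
Proof.
have ext (V : finType) (c : {set V} -> bool) col (A B : {set V}) x :
    x \in A -> B \subset [set y in A :\ x | c [set x; y] == col] ->
    mono_clique c col B ->
    [/\ x |: B \subset A, #|x |: B| = #|B|.+1 & mono_clique c col (x |: B)].
  move=> xA /subsetP sB mB; split.
  - apply/subsetP=> y; rewrite !inE => /orP[/eqP-> //|/sB].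
    by rewrite !inE => /andP[/andP[_ ->]].
  - rewrite cardsU1; case: (boolP (x \in B)) => [/sB|//].
    by rewrite !inE eqxx.
  - move=> y z; rewrite !inE => /orP[/eqP->|yB] /orP[/eqP->|zB].
    + by rewrite eqxx.
    + by move: (sB _ zB); rewrite !inE => /andP[_ /eqP].
    + by move: (sB _ yB); rewrite setUC !inE => /andP[_ /eqP].
    + exact: mB.
elim: s t => [|s IHs] t.
  exists 0 => V c A _; left; exists set0; rewrite sub0set cards0.
  by split=> // x y; rewrite inE.
elim: t => [|t [N2 IHt]].
  exists 0 => V c A _; right; exists set0; rewrite sub0set cards0.
  by split=> // x y; rewrite inE.
have [N1 {}IHs] := IHs t.+1.
exists (N1 + N2).+1 => V c A leNA.
have [x xA] : exists x, x \in A.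
  by apply/set0Pn; rewrite -card_gt0; apply: leq_trans leNA.
pose nb col := [set y in A :\ x | c [set x; y] == col].
have nbA col : nb col \subset A.
  by apply/subsetP=> y; rewrite !inE => /andP[/andP[]].
have card_nb : N1 + N2 <= #|nb true| + #|nb false|.
  have eqA : A :\ x = nb true :|: nb false.
    by apply/setP=> y; rewrite !inE; case: (c _); rewrite !(andbT, andbF, orbF).
  have: N1 + N2 <= #|A :\ x| by move: leNA; rewrite (cardsD1 x A) xA.
  by rewrite eqA cardsU => /leq_trans; apply; apply: leq_subr.
case: (leqP N1 #|nb true|) => [le1|lt1].
  case: (IHs V c _ le1) => [[B [sB cB mB]]|[B [sB cB mB]]].
    have [? cB' ?] := ext V c true A B x xA sB mB.
    by left; exists (x |: B); rewrite cB' cB.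
  by right; exists B; rewrite (subset_trans sB).
have le2 : N2 <= #|nb false|.
  rewrite leqNgt; apply/negP=> lt2.
  by have := leq_add lt1 (ltnW lt2); rewrite addSn ltnNge card_nb.
case: (IHt V c _ le2) => [[B [sB cB mB]]|[B [sB cB mB]]].
  by left; exists B; rewrite (subset_trans sB).
have [? cB' ?] := ext V c false A B x xA sB mB.
by right; exists (x |: B); rewrite cB' cB.
Qed.

Lemma mono_clique_copy (N : nat) (c : {ffun {set 'I_N} -> bool}) (col : bool)
    (G : sgraph) (B : {set 'I_N}) :
  #|B| = #|G| -> mono_clique c col B -> mono_copy c col G.
Proof.
move=> cB mB; pose g (x : G) := enum_val (cast_ord (esym cB) (enum_rank x)).
have g_inj : injective g.
  by move=> x y /enum_val_inj /cast_ord_inj /enum_rank_inj.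
apply/existsP; exists (finfun g); apply/andP; split.
  by apply/injectiveP=> x y; rewrite !ffunE => /g_inj.
apply/forallP=> x; apply/forallP=> y; apply/implyP=> xy; rewrite !ffunE.
apply/eqP/mB; rewrite ?enum_valP // (inj_eq g_inj).
by apply: contraTneq xy => ->; rewrite adj_irrefl.
Qed.

Lemma arrows_exists (G1 G2 : sgraph) : exists N, arrows G1 G2 N.
Proof.
have [N HN] := ramsey_clique #|G1| #|G2|.
exists N.+1; apply/andP; split=> //; apply/forallP=> c; apply/orP.
have leN : N <= #|[set: 'I_N.+1]| by rewrite cardsT card_ord.
by case: (HN _ c _ leN) => -[B [_ cB mB]]; [left|right];
  apply: mono_clique_copy cB mB.
Qed.

Definition ramsey (G1 G2 : sgraph) : nat := ex_minn (arrows_exists G1 G2).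

(* Meant for trees T and S with #|S| <= #|T|. *)
Definition ramsey_lower (T S : sgraph) : nat :=
  let n := #|T| in let nu := #|S| in
  let t1 := larger_class T in let t2 := smaller_class T in
  let tau1 := larger_class S in let tau2 := smaller_class S in
  maxn (maxn (n + tau2) (nu + minn t2 nu))
       (maxn (minn (2 * t1) (2 * nu)) (2 * tau1)) - 1.

(* Main.v *)
Require Import Defs.
From mathcomp Require Import all_boot.
From mathcomp Require Import zify.

(* Write m = 3^C and K = (m+1)r - 1. Colour 2K + C vertices by joining two red
   cliques A and B of size K by blue edges, and making the C remaining vertices
   red to everything. A blue copy of a connected graph lies in the bipartite
   graph between A and B, where a class of size K + 1 does not fit.
   T is a complete ternary tree of depth C whose m leaves are replaced by trees
   ("blobs") of 2r vertices. In a red copy of T, the at most C vertices outside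
   A and B cut T into pieces, each lying in A or in B. Because of the ternary
   branching, C cuts cannot halve the m blobs: if k cuts are at branch vertices
   and w in blobs, the numbers of blobs with root on the two sides differ by at
   least 3^(C-k) >= 3^w >= 1 + 2w. So one side has at least (m+1)/2 uncut
   blobs, that is, at least (m+1)r > K vertices. *)

Set Implicit Arguments.
Unset Strict Implicit.
Unset Printing Implicit Defensive.

(** * Trees given by a parent function *)

Lemma card_ordE (P : nat -> bool) k : #|[set x : 'I_k | P x]| = \sum_(i < k) P i.
Proof. by rewrite -sum1_card big_mkcond; apply: eq_bigr => i _; rewrite inE; case: (P i). Qed.

Section ParentTree.

Variables (p : nat -> nat) (n : nat).

(** The test [y < x] leaves the root 0 without a parent, whatever [p 0] is. *)
Definition parent_adj (x y : 'I_n.+1) : bool :=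
  ((y < x) && (p x == y)) || ((x < y) && (p y == x)).

Lemma parent_adj_sym : symmetric parent_adj.
Proof. by move=> x y; rewrite /parent_adj orbC. Qed.

Lemma parent_adj_irrefl : irreflexive parent_adj.
Proof. by move=> x; rewrite /parent_adj ltnn. Qed.

Definition parent_graph : sgraph := SGraph parent_adj_sym parent_adj_irrefl.

Lemma card_parent_graph : #|parent_graph| = n.+1.
Proof. exact: card_ord. Qed.

Hypothesis p_lt : forall i, 0 < i <= n -> p i < i.

Lemma parent_adjP i : 0 < i <= n -> parent_adj (inord i) (inord (p i)).
Proof.
move=> hi; have := p_lt hi; rewrite /parent_adj => lt.
by rewrite !inordK ?lt ?eqxx //; lia.
Qed.

Lemma parent_graph_tree : is_tree parent_graph.
Proof.
split; first by rewrite card_parent_graph.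
- have c0 i : i <= n -> connect parent_adj (inord i) (inord 0).
    elim/ltn_ind: i => -[//|i] IH le.
    have lt : p i.+1 < i.+1 by apply: p_lt; lia.
    apply: connect_trans (IH _ lt _); last by lia.
    by apply: connect1; apply: parent_adjP.
  have cs : connect_sym parent_adj by apply: sym_connect_sym; exact: parent_adj_sym.
  move=> x y; apply: (@connect_trans _ _ (inord 0)).
    by rewrite -[x]inord_val; apply: c0; rewrite -ltnS.
  by rewrite [connect _ _ _]cs -[y]inord_val; apply: c0; rewrite -ltnS.
- (* Both cyclic neighbours of the largest vertex are its parent. *)
  move=> c /andP[cyc unq]; rewrite leqNgt; apply/negP => sz.
  have [x0 x0c] : exists x0, x0 \in c.
    by case: c sz {cyc unq} => // a c _; exists a; rewrite mem_head.
  case: (arg_maxnP (P := mem c) (fun i : 'I_n.+1 => nat_of_ord i) x0c) => x xc xmax.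
  have [i s rc] := rot_to xc.
  move: cyc unq sz xmax; rewrite -(rot_cycle i) -(rot_uniq i) -(size_rot i) rc.
  case: s rc => [|y [|z s]] rc //= /andP[xy]; rewrite rcons_path => /and3P[_ _ zx].
  move=> /and3P[_ yNs _] _ xmax.
  have mem_c u : u \in x :: y :: z :: s -> u \in c by rewrite -rc mem_rot.
  have up u : u \in c -> (parent_adj x u || parent_adj u x) -> p x = u.
    move=> uc; have le : u <= x := xmax u uc.
    by case/orP => /orP[] /andP[lt /eqP] //; move: lt; rewrite ltnNge le.
  have ey : p x = y.
    by apply: up; [apply: mem_c; rewrite !inE eqxx orbT | rewrite [parent_adj x y]xy].
  have ez : p x = last z s.
    apply: up; first by apply: mem_c; rewrite in_cons in_cons mem_last !orbT.
    by rewrite [parent_adj (last z s) x]zx orbT.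
  have eyz : y = last z s by apply/val_inj; rewrite /= -ey ez.
  by rewrite eyz mem_last in yNs.
Qed.

Lemma parent_graph_classes (col : nat -> bool) (a b : nat) :
    (forall i, 0 < i <= n -> col i = ~~ col (p i)) ->
    \sum_(i < n.+1) col i = a -> a + b = n.+1 ->
  has_class_sizes parent_graph a b.
Proof.
move=> hcol sa eab; exists [set x : 'I_n.+1 | col x].
have ca : #|[set x : 'I_n.+1 | col x]| = a by rewrite card_ordE.
split=> //.
  2: by apply: (@addnI a); rewrite eab -{1}ca cardsC card_parent_graph.
apply/forallP => x; apply/forallP => y; apply/implyP; rewrite !inE /= /parent_adj.
have step (u v : 'I_n.+1) : v < u -> p u = v -> col u != col v.
  move=> lt <-; rewrite hcol; first by case: (col _).
  by have := ltn_ord u; lia.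
by case/orP => /andP[lt /eqP e]; [|rewrite eq_sym]; apply: step.
Qed.

Lemma parent_graph_degree (d : nat) (ch : nat -> seq nat) :
    (forall i, 0 < i <= n -> i \in ch (p i)) ->
    (forall i, size (ch i) <= d) ->
  max_degree parent_graph <= d.+1.
Proof.
move=> hch hs; apply/bigmax_leqP => x _.
apply: leq_trans (_ : size (p x :: ch x) <= _); last by rewrite /= ltnS.
rewrite cardE -(size_map val); apply: uniq_leq_size.
  by rewrite map_inj_uniq ?enum_uniq //; exact: val_inj.
move=> _ /mapP[y + ->]; rewrite mem_enum inE /= /parent_adj in_cons.
case/orP => /andP[lt /eqP e]; first by rewrite -e eqxx.
apply/orP; right; rewrite -e; apply: hch.
by have := ltn_ord y; lia.
Qed.

End ParentTree.

(** * Bipartition classes of a connected graph *)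

Lemma bip_class_connected (G : sgraph) (A B : {set G}) :
    (forall x y : G, connect (@adj G) x y) -> bip_class A -> bip_class B ->
  B = A \/ B = ~: A.
Proof.
move=> conn /forallP bA /forallP bB.
(* Both memberships flip along every edge, so agreement of [A] and [B] at one vertex spreads to
   all. *)
have step x y : connect (@adj G) x y -> ((x \in A) == (x \in B)) = ((y \in A) == (y \in B)).
  case/connectP => s + ->; elim: s x => //= u s IH x /andP[xu /IH <-].
  have := forallP (bA x) u; have := forallP (bB x) u; rewrite xu /=.
  by do 4!case: (_ \in _).
have [/existsP[x ex]|/existsPn nex] := boolP [exists x : G, (x \in A) == (x \in B)].
  by left; apply/setP => y; move: ex; rewrite (step x y (conn x y)) => /eqP.
by right; apply/setP => y; rewrite inE; have := nex y; do 2!case: (_ \in _).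
Qed.

Lemma tree_class_sizes (G : sgraph) (a b : nat) :
    is_tree G -> has_class_sizes G a b -> b <= a ->
  [/\ #|G| = a + b, larger_class G = a & smaller_class G = b].
Proof.
move=> [_ conn _] [A [bA cA cC]] leba.
have cG : #|G| = a + b by rewrite -cA -cC cardsC.
have lG : larger_class G = a.
  apply/eqP; rewrite eqn_leq; apply/andP; split.
    apply/bigmax_leqP => B bB.
    by case: (bip_class_connected conn bA bB) => ->; rewrite ?cA ?cC.
  by rewrite -cA; apply: (leq_bigmax_cond (F := fun B : {set G} => #|B|)).
by split=> //; rewrite /smaller_class lG cG addKn.
Qed.

(** * Block sums and the levels of the ternary tree *)

Lemma sum_ord_add (n k : nat) (F : nat -> nat) :
  \sum_(i < n + k) F i = \sum_(i < n) F i + \sum_(i < k) F (n + i).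
Proof. by rewrite big_split_ord. Qed.

Lemma sum_ord_mul (n m : nat) (F : nat -> nat) :
  \sum_(t < n * m) F t = \sum_(b < m) \sum_(j < n) F (j * m + b).
Proof.
rewrite exchange_big; elim: n => [|n IH] /=; first by rewrite !big_ord0.
by rewrite mulSnr sum_ord_add IH big_ord_recr.
Qed.

Lemma sum_ord_mul3 (n : nat) (F : nat -> nat) :
  \sum_(t < 3 * n) F t = \sum_(i < n) (F (3 * i) + F (3 * i + 1) + F (3 * i + 2)).
Proof.
elim: n => [|n IH]; first by rewrite !big_ord0.
by rewrite mulnS addnC sum_ord_add IH !big_ord_recr big_ord0 /= add0n addn0.
Qed.

(* The number of vertices above level [l] in the infinite ternary tree. *)
Definition ternary_size (l : nat) : nat := (3 ^ l - 1) %/ 2.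

Lemma ternary_sizeS l : ternary_size l.+1 = 3 * ternary_size l + 1.
Proof.
have odd3 : odd (3 ^ l) by rewrite oddX orbT.
by rewrite /ternary_size expnS; lia.
Qed.

Lemma expn3E l : 3 ^ l = 2 * ternary_size l + 1.
Proof. by elim: l => // l IH; rewrite ternary_sizeS expnS IH; lia. Qed.

Lemma sum_ternary_size l (F : nat -> nat) :
  \sum_(v < ternary_size l) F v =
    \sum_(h < l) \sum_(i < 3 ^ h) F (ternary_size h + i).
Proof.
elim: l => [|l IH]; first by rewrite !big_ord0.
have -> : ternary_size l.+1 = ternary_size l + 3 ^ l by rewrite ternary_sizeS expn3E; lia.
by rewrite sum_ord_add IH big_ord_recr.
Qed.

(** Level [l] consists of the [i] with [3 ^ l <= 2 * i + 1 < 3 ^ l.+1], since [ternary_size l] is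
    [(3 ^ l - 1) / 2]. *)
Definition ternary_level (i : nat) : nat := trunc_log 3 i.*2.+1.

Lemma ternary_levelE l i : i < 3 ^ l -> ternary_level (ternary_size l + i) = l.
Proof.
move=> lt; apply: trunc_log_eq => //; rewrite expnS.
by have := expn3E l; lia.
Qed.

Lemma ternary_level_parent i : 0 < i -> ternary_level i = (ternary_level (i.-1 %/ 3)).+1.
Proof.
move=> i_gt0; apply: trunc_log_eq => //.
have /= := @trunc_log_bounds 3 (i.-1 %/ 3).*2.+1 isT isT.
rewrite -/(ternary_level _); set l := ternary_level _.
by rewrite !expnS expn3E; lia.
Qed.

(** * Combs *)

(* Parent function of a path on [2 * a] vertices, followed by leaves attached
   to its odd vertices, [k] leaves to each. *)
Definition comb (k a i : nat) : nat :=
  if i < 2 * a then i.-1 else (2 * ((i - 2 * a) %/ k)).+1.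

Definition comb_color (a i : nat) : bool := (2 * a <= i) || ~~ odd i.

(** An overestimate: leaves are listed for even [i] too. Containing all true children suffices for
    the degree bound. *)
Definition comb_children (k a i : nat) : seq nat :=
  i.+1 :: iota (2 * a + k * i./2) k.

Lemma comb_lt k a i : 1 < k -> 0 < a -> 0 < i -> comb k a i < i.
Proof.
rewrite /comb => k_gt1 a_gt0 i_gt0; case: ifP => h; first by lia.
have := leq_divM (i - 2 * a) k; set q := _ %/ _.
by have := leq_mul (leqnn q) k_gt1; lia.
Qed.

Lemma comb_in_children k a i : 0 < k -> 0 < i -> i \in comb_children k a (comb k a i).
Proof.
rewrite /comb_children /comb inE mem_iota => k_gt0 i_gt0.
case: ifP => h; first by rewrite prednK // eqxx.
have := divn_eq (i - 2 * a) k; have := ltn_pmod (i - 2 * a) k_gt0.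
set q := _ %/ _ => lt e; have -> : (2 * q).+1./2 = q by lia.
by rewrite orbC; apply/orP; left; lia.
Qed.

Lemma comb_colorE k a t i : 0 < a -> 0 < k -> t <= k * a -> 0 < i < 2 * a + t ->
  comb_color a i = ~~ comb_color a (comb k a i).
Proof.
rewrite /comb_color /comb => a_gt0 k_gt0 ht hi; case: ifP => h.
  by rewrite leqNgt h [2 * a <= _]leqNgt (leq_ltn_trans (leq_pred i) h) /=; lia.
have lt : (i - 2 * a) %/ k < a by rewrite ltn_divLR //; nia.
by set q := (_ %/ k) in lt *; lia.
Qed.

Lemma sum_comb_color a t : \sum_(i < 2 * a + t) comb_color a i = a + t.
Proof.
rewrite (@sum_ord_add _ _ (comb_color a)); congr (_ + _).
  transitivity (\sum_(i < 2 * a) ~~ odd i).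
    by apply: eq_bigr => i _; rewrite /comb_color leqNgt ltn_ord.
  elim: a => [|a IH]; first by rewrite big_ord0.
  by rewrite mulnS addnC !addnS addn0 !big_ord_recr /= IH; lia.
rewrite (eq_bigr (fun=> 1)) ?sum_nat_const ?card_ord ?muln1 // => i _.
by rewrite /comb_color leq_addr.
Qed.

Lemma comb_graph_spec (k a t : nat) (G := parent_graph (comb k a) (2 * a + t).-1) :
    0 < a -> 1 < k -> t <= k * a ->
  [/\ is_tree G, max_degree G <= k.+2 & has_class_sizes G (a + t) a].
Proof.
move=> a_gt0 k_gt1 ht; have k_gt0 := ltnW k_gt1; split.
- by apply: parent_graph_tree => i /andP[i_gt0 _]; apply: comb_lt.
- apply: (parent_graph_degree (ch := comb_children k a)) => i.
    by move=> /andP[i_gt0 _]; apply: comb_in_children.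
  by rewrite /= size_iota.
- apply: (parent_graph_classes (col := comb_color a)).
  + by move=> i hi; apply: (comb_colorE (t := t)) => //; lia.
  + by rewrite prednK ?sum_comb_color //; lia.
  + by lia.
Qed.

(** * Propagation of signs down the ternary tree *)

(* [z] marks the cut vertices, i.e. those outside A and B, and [x] tells on
   which side the other ones are; a cut vertex inherits the sign of its parent,
   so that signs only change just below cut vertices. *)
Section SignPropagation.

Variables (x z : nat -> bool).

Fixpoint sign (l i : nat) : bool :=
  if l is l'.+1 then
    if z (ternary_size l + i) then sign l' (i %/ 3) else x (ternary_size l + i)
  else x i.

Definition positives (l : nat) : nat := \sum_(i < 3 ^ l) sign l i.

Definition cuts (l : nat) : nat := \sum_(i < 3 ^ l) z (ternary_size l + i).

Variable C : nat.

Hypothesis x_heap : forall v, 0 < v < ternary_size C.+1 ->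
  ~~ z v -> ~~ z (v.-1 %/ 3) -> x v = x (v.-1 %/ 3).

(** An uncut child agrees with its uncut parent by [x_heap], a cut child by inheritance. *)
Lemma sign_child l i c : l < C -> i < 3 ^ l -> c < 3 ->
  ~~ z (ternary_size l + i) -> sign l.+1 (3 * i + c) = sign l i.
Proof.
move=> lC il c3 nz /=; have -> : (3 * i + c) %/ 3 = i by lia.
case: ifP => // /negbT nzc.
have par : (ternary_size l.+1 + (3 * i + c)).-1 %/ 3 = ternary_size l + i.
  by rewrite ternary_sizeS; lia.
rewrite x_heap ?par //; first by case: (l) nz => // l' nz /=; rewrite (negbTE nz).
have := leq_pexp2l (isT : 0 < 3) lC; rewrite !ternary_sizeS !expn3E ternary_sizeS.
by move: il; rewrite expn3E; lia.
Qed.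

Arguments sign : simpl never.

(** Tripling is exact except below cut vertices, each of which disturbs at most three children. *)
Lemma positivesS l : l < C ->
  (positives l.+1 <= 3 * positives l + 3 * cuts l) *
  (3 * positives l <= positives l.+1 + 3 * cuts l).
Proof.
move=> lC; rewrite /positives /cuts expnS (@sum_ord_mul3 _ (sign l.+1)).
rewrite !big_distrr -!big_split /=.
have key i : i < 3 ^ l ->
    ~~ z (ternary_size l + i) ->
    [/\ sign l.+1 (3 * i) = sign l i, sign l.+1 (3 * i + 1) = sign l i
      & sign l.+1 (3 * i + 2) = sign l i].
  move=> il nz; have E := sign_child lC il _ nz.
  by split; rewrite ?E // -[3 * i]addn0 E.
split; apply: leq_sum => i _; have := key i (ltn_ord i);
  case: (z _) => [_|/(_ isT)[-> -> ->]]; first 1 last.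
- by case: (sign _ _).
- by do 4!case: (sign _ _).
- by case: (sign _ _).
- by do 4!case: (sign _ _).
Qed.

(* [2 * positives l - 3 ^ l] is the signed sum over level [l]: passing to the
   next level multiplies it by 3 up to an error of 6 per cut vertex, and its
   oddness takes over once the number of cuts reaches [l]. *)
Lemma sign_imbalance l : l <= C ->
  let g := 3 ^ (l - \sum_(h < l) cuts h) in
  (2 * positives l + g <= 3 ^ l) || (3 ^ l + g <= 2 * positives l).
Proof.
elim: l => [_|l IH lC] /=.
  by rewrite big_ord0 /positives big_ord1; case: (sign _ _).
have {IH} := IH (ltnW lC); rewrite big_ord_recr /=.
set Z := \sum_(h < l) _; have [up dn] := positivesS lC; move: up dn.
set k := cuts l; set P := positives l; set Q := positives l.+1 => up dn.
have [le|gt] := leqP l.+1 (Z + k).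
  move=> _; have -> : l.+1 - (Z + k) = 0 by lia.
  by rewrite expn0 expn3E; lia.
(* The old gap is [q * 3 ^ k >= q + 2 * k]; tripling it and losing [6 * k] leaves the required
   [3 * q]. *)
have -> : l - Z = (l - (Z + k)) + k by lia.
have -> : l.+1 - (Z + k) = (l - (Z + k)).+1 by lia.
rewrite expnD !expnS; set q := 3 ^ (l - (Z + k)).
have q_gt0 : 0 < q by rewrite expn_gt0.
have k3 : 2 * k + 1 <= 3 ^ k.
  by elim: (k) => // k' IHk; rewrite expnS; lia.
have : q + 2 * k <= q * 3 ^ k.
  apply: leq_trans (leq_mul (leqnn q) k3).
  by rewrite mulnDr muln1 addnC leq_add2r leq_pmull.
by set w := q * 3 ^ k; set tl := 3 ^ l; lia.
Qed.

End SignPropagation.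

(** * The ternary tree with blobs *)

(* The complete ternary tree with [C] levels of branch vertices, numbered in
   breadth-first order, whose [m = 3 ^ C] leaves are the roots of combs
   ("blobs"); vertex [j] of blob [b] has number [M + (j * m + b)], the root
   being [j = 0], and [a b] is the size of the smaller class of blob [b]. *)
Section BlownUpTernaryTree.

Variables (C : nat) (a : nat -> nat).

Let M := ternary_size C.
Let m := 3 ^ C.

Definition blown_parent (i : nat) : nat :=
  if i < M + m then i.-1 %/ 3
  else M + (comb 2 (a ((i - M) %% m)) ((i - M) %/ m) * m + (i - M) %% m).

(** Levels of the parity of [C] get [true], to match the blob roots, which [comb_color] sends to
    [true]. *)
Definition blown_color (i : nat) : bool :=
  if i < M then odd (ternary_level i) == odd C
  else comb_color (a ((i - M) %% m)) ((i - M) %/ m).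

(** Again an overestimate; for [i < M] the truncated [i - M] only adds spurious entries. *)
Definition blown_children (i : nat) : seq nat :=
  [:: 3 * i + 1; 3 * i + 2; 3 * i + 3] ++
  [seq M + (j * m + (i - M) %% m)
     | j <- comb_children 2 (a ((i - M) %% m)) ((i - M) %/ m)].

Let m_gt0 : 0 < m. Proof. by rewrite expn_gt0. Qed.

Lemma blob_coordP i : M <= i -> exists b j, b < m /\ i = M + (j * m + b).
Proof.
move=> le; exists ((i - M) %% m), ((i - M) %/ m).
by rewrite ltn_pmod // -divn_eq subnKC.
Qed.

Let div_coord b j : b < m -> (M + (j * m + b) - M) %/ m = j.
Proof. by move=> bm; rewrite addKn divnMDl // divn_small // addn0. Qed.

Let mod_coord b j : b < m -> (M + (j * m + b) - M) %% m = b.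
Proof. by move=> bm; rewrite addKn modnMDl modn_small. Qed.

Lemma blown_parent_heap i : i < M + m -> blown_parent i = i.-1 %/ 3.
Proof. by rewrite /blown_parent => ->. Qed.

Lemma blown_parent_blob b j : b < m -> 0 < j ->
  blown_parent (M + (j * m + b)) = M + (comb 2 (a b) j * m + b).
Proof.
move=> bm j_gt0; rewrite /blown_parent div_coord // mod_coord // ifN //.
by rewrite -leqNgt leq_add2l (leq_trans (leq_pmull m j_gt0)) ?leq_addr.
Qed.

Lemma blown_color_blob b j : b < m ->
  blown_color (M + (j * m + b)) = comb_color (a b) j.
Proof.
by move=> bm; rewrite /blown_color div_coord // mod_coord // ifN // -leqNgt leq_addr.
Qed.

Hypothesis a_gt0 : forall b, b < m -> 0 < a b.

Variant blown_spec (i : nat) : Prop :=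
  | BlownHeap of i < M + m & blown_parent i = i.-1 %/ 3
  | BlownBlob b j of b < m & 0 < j & i = M + (j * m + b)
      & blown_parent i = M + (comb 2 (a b) j * m + b).

Lemma blownP i : blown_spec i.
Proof.
have [lt|ge] := ltnP i (M + m); first by left=> //; apply: blown_parent_heap.
have [b [j [bm ei]]] := blob_coordP (leq_trans (leq_addr m M) ge).
have j_gt0 : 0 < j by case: j ei ge => [|//] ->; lia.
by apply: (BlownBlob bm j_gt0 ei); rewrite ei blown_parent_blob.
Qed.

Lemma blown_parent_lt i : 0 < i -> blown_parent i < i.
Proof.
case: (blownP i) => [_ -> | b j bm j_gt0 -> -> _]; first by lia.
by rewrite ltn_add2l ltn_add2r ltn_pmul2r // comb_lt // a_gt0.
Qed.

Lemma blown_in_children i : 0 < i -> i \in blown_children (blown_parent i).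
Proof.
rewrite /blown_children mem_cat.
case: (blownP i) => [_ -> | b j bm j_gt0 -> -> _]; first by rewrite !inE; lia.
apply/orP; right; rewrite div_coord // mod_coord //.
by apply/mapP; exists j => //; apply: comb_in_children.
Qed.

(** The bounds on [L] say that a blob of [L] vertices contains its path of [2 * a b] vertices and
    has at most two leaves per odd path vertex. *)
Lemma blown_colorE L i :
    (forall b, b < m -> 2 * a b <= L <= 4 * a b) -> 0 < i < M + L * m ->
  blown_color i = ~~ blown_color (blown_parent i).
Proof.
move=> hL /andP[i_gt0]; case: (blownP i) => [lt -> _ | b j bm j_gt0 -> ->].
  have color_heap k : k < M + m -> blown_color k = (odd (ternary_level k) == odd C).
    move=> lt'; rewrite /blown_color; case: ltnP => // ge.
    have km : k - M < m by lia.
    rewrite -{3}(subnKC ge) ternary_levelE // eqxx divn_small //.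
    by rewrite /comb_color orbT.
  rewrite !color_heap //; last by lia.
  by rewrite (ternary_level_parent i_gt0) /=; case: (odd _); case: (odd C).
rewrite ltn_add2l => ltL; have jL : j < L.
  by rewrite -(ltn_pmul2r m_gt0); apply: leq_ltn_trans ltL; apply: leq_addr.
have := hL b bm; rewrite !blown_color_blob // => hb.
by apply: (comb_colorE (t := L - 2 * a b)); rewrite ?a_gt0 //; lia.
Qed.

Lemma sum_blown L (F : nat -> nat) :
  \sum_(v < M + L * m) F v = \sum_(v < M) F v +
    \sum_(b < m) \sum_(j < L) F (M + (j * m + b)).
Proof. by rewrite sum_ord_add (@sum_ord_mul _ _ (fun t => F (M + t))). Qed.

Lemma sum_blown_color L :
    (forall b, b < m -> 2 * a b <= L <= 4 * a b) ->
  \sum_(v < M + L * m) blown_color v =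
    \sum_(v < M) (odd (ternary_level v) == odd C) + \sum_(b < m) (L - a b).
Proof.
move=> hL; rewrite (@sum_blown L blown_color); congr (_ + _); apply: eq_bigr => i _.
  by rewrite /blown_color ltn_ord.
have hb := hL i (ltn_ord i).
under eq_bigr do rewrite blown_color_blob //.
have := sum_comb_color (a i) (L - 2 * a i); rewrite subnKC => [->|]; by lia.
Qed.

(** Here [M.+1] is [(m + 1) / 2]. One sign occurs at enough blob roots to leave [M.+1] of these
    blobs after discarding one for each cut inside a blob; an uncut blob lies wholly on the side of
    its root. *)
Lemma blown_unbalanced L (x z : nat -> bool) :
    (forall v, 0 < v < M + L * m ->
       ~~ z v -> ~~ z (blown_parent v) -> x v = x (blown_parent v)) ->
    0 < L -> \sum_(v < M + L * m) z v <= C ->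
  exists s : bool, L * M.+1 <= \sum_(v < M + L * m) ((x v == s) && ~~ z v).
Proof.
move=> hx L_gt0; rewrite (@sum_blown L z) => zC.
pose W b := \sum_(j < L) z (M + (j * m + b)).
have x_heap v : 0 < v < ternary_size C.+1 ->
    ~~ z v -> ~~ z (v.-1 %/ 3) -> x v = x (v.-1 %/ 3).
  have := expn3E C; rewrite ternary_sizeS -/M -/m => em /andP[v_gt0 lt].
  rewrite -blown_parent_heap; last by lia.
  by apply: hx; rewrite v_gt0 /=; have := leq_pmull m L_gt0; lia.
have blob s b : b < m ->
    L * (sign x z C b == s) <=
      \sum_(j < L) ((x (M + (j * m + b)) == s) && ~~ z (M + (j * m + b))) + L * W b.
  move=> bm; case: (posnP (W b)) => [W0|W_gt0]; last first.
    by apply: leq_trans (leq_addl _ _); case: (_ == _); rewrite ?muln0 ?leq_pmul2l.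
  have nz j : j < L -> ~~ z (M + (j * m + b)).
    move=> jL; apply/negP => zj; move/eqP: W0.
    by rewrite /W (bigD1 (Ordinal jL)) //= zj.
  have xE j : j < L -> x (M + (j * m + b)) = sign x z C b.
    elim/ltn_ind: j => -[|j] IH jL.
      have := nz 0 jL; rewrite mul0n add0n /sign /M.
      case: (C) => [|C'] /=; first by [].
      by move=> h; rewrite (negbTE h).
    have lt := comb_lt (isT : 1 < 2) (a_gt0 bm) (isT : 0 < j.+1).
    have ltL := ltn_trans lt jL.
    have pE := @blown_parent_blob b j.+1 bm isT.
    rewrite -(IH _ lt ltL) hx ?pE ?nz //.
    have : j.+1 * m + m <= L * m by rewrite -mulSnr leq_mul2r jL orbT.
    by lia.
  rewrite W0 muln0 addn0 (eq_bigr (fun=> (sign x z C b == s) : nat)).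
    by rewrite sum_nat_const card_ord.
  by move=> j _; rewrite xE // nz // andbT.
pose P s := \sum_(b < m) (sign x z C b == s).
have PN : P true + P false = m.
  rewrite /P -big_split /= -[RHS]card_ord -sum1_card.
  by apply: eq_bigr => b _; case: (sign _ _ _ _).
have Ppos : P true = positives x z C.
  by apply: eq_bigr => b _; case: (sign _ _ _ _).
(* With [w] cuts in blobs the gap is at least [2 * w + 1], so the majority sign has at least
   [(m + 2 * w + 1) / 2 = M + 1 + w] roots. *)
have [s Ps] : exists s, M.+1 + \sum_(b < m) W b <= P s.
  have /= := sign_imbalance x_heap (leqnn C).
  move: zC; rewrite (@sum_ternary_size C z) -/(cuts z).
  rewrite (eq_bigr (fun h : 'I_C => cuts z h)) // -Ppos.
  set Z := \sum_(h < C) _; set w := \sum_(b < m) _ => zC.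
  have : 2 * w + 1 <= 3 ^ (C - Z).
    apply: (@leq_trans (3 ^ w)); last by rewrite leq_pexp2l //; lia.
    by elim: (w) => // k IH; rewrite expnS; lia.
  have := expn3E C; rewrite -/m -/M => em; set g := 3 ^ _ => wg /orP[h|h].
    by exists false; lia.
  by exists true; lia.
exists s; rewrite (@sum_blown L (fun v => (x v == s) && ~~ z v)).
apply: leq_trans (leq_addl _ _); rewrite -(leq_add2r (L * \sum_(b < m) W b)) -mulnDr.
apply: (@leq_trans (L * P s)); first by rewrite leq_mul2l Ps orbT.
rewrite /P !big_distrr -big_split /=.
by apply: leq_sum => b _; apply: blob.
Qed.

End BlownUpTernaryTree.

(** * The colouring and its lack of monochromatic copies *)

Lemma card_interval_preim (T : finType) (N lo k : nat) (f : T -> 'I_N) (A : {set T}) :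
  injective f -> (forall x, x \in A -> lo <= f x < lo + k) -> #|A| <= k.
Proof.
move=> finj hA; rewrite cardE -(size_map (fun x => f x : nat)) -(size_iota lo k).
apply: uniq_leq_size.
  by rewrite map_inj_uniq ?enum_uniq // => x y /val_inj/finj.
by move=> _ /mapP[x + ->]; rewrite mem_enum mem_iota; apply: hA.
Qed.

(** The clique A is the numbers below [K], B those from [K] to [2 * K - 1]. As [N] is free, one
    formula serves every [N <= 2 * K + C]. *)
Definition split_coloring (K N : nat) : {ffun {set 'I_N} -> bool} :=
  [ffun e : {set 'I_N} => ~~ ([exists u in e, u < K] && [exists v in e, K <= v < 2 * K])].

Lemma split_coloringE K N (u v : 'I_N) :
  split_coloring K N [set u; v] =
    ~~ ((u < K) && (K <= v < 2 * K) || (v < K) && (K <= u < 2 * K)).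
Proof.
have ex2 (P : pred 'I_N) : [exists w in [set u; v], P w] = P u || P v.
  apply/existsP/orP => [[w]|[Pu|Pv]].
  - by rewrite !inE => /andP[/orP[] /eqP ->]; [left|right].
  - by exists u; rewrite !inE eqxx Pu.
  - by exists v; rewrite !inE eqxx orbT Pv.
by rewrite ffunE (ex2 (fun w => w < K)) (ex2 (fun w => K <= w < 2 * K)); lia.
Qed.

Lemma mono_copyP N (c : {ffun {set 'I_N} -> bool}) col (G : sgraph) :
  mono_copy c col G -> exists2 f : G -> 'I_N, injective f &
    forall x y, adj x y -> c [set f x; f y] = col.
Proof.
case/existsP => f /andP[/injectiveP finj /forallP fc]; exists f => // x y xy.
by apply/eqP; apply: implyP (forallP (fc x) y) xy.
Qed.

(** Blue edges join A to B, so the preimages of A and of B both satisfy [bip_class]. Having at most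
    [K < a] elements, both equal the class of size [b], yet they are disjoint and [b > 0]. *)
Lemma split_coloring_no_blue (K N a b : nat) (G : sgraph) :
    is_tree G -> has_class_sizes G a b -> K < a -> 0 < b ->
  ~~ mono_copy (split_coloring K N) false G.
Proof.
move=> [_ conn _] [A0 [bA cA cC]] Ka b_gt0.
apply/negP => /mono_copyP[f finj fc].
pose PA := [set x | f x < K]; pose PB := [set x | K <= f x < 2 * K].
have bPA : bip_class PA.
  apply/forallP => x; apply/forallP => y; apply/implyP => /fc.
  by rewrite split_coloringE !inE; lia.
have bPB : bip_class PB.
  apply/forallP => x; apply/forallP => y; apply/implyP => /fc.
  by rewrite split_coloringE !inE; lia.
have cPA : #|PA| <= K by apply: (card_interval_preim (lo := 0) finj) => x; rewrite inE; lia.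
have cPB : #|PB| <= K by apply: (card_interval_preim (lo := K) finj) => x; rewrite inE; lia.
have eA : PA = ~: A0.
  by case: (bip_class_connected conn bA bPA) => // e; move: cPA; rewrite e cA leqNgt Ka.
have eB : PB = ~: A0.
  by case: (bip_class_connected conn bA bPB) => // e; move: cPB; rewrite e cA leqNgt Ka.
have /card_gt0P[x xC] : 0 < #|~: A0| by rewrite cC.
by move: (xC) (xC); rewrite -{1}eA -eB !inE; lia.
Qed.

(** The vertices sent to [2 * K] or beyond are the cuts, at most [C] of them; a red edge between
    uncut vertices stays on one side, so [blown_unbalanced] puts more than [K] vertices on one
    side. *)
Lemma split_coloring_no_red (C r K N n : nat) (a : nat -> nat) :
    (forall b, b < 3 ^ C -> 0 < a b) -> 0 < r ->
    n.+1 = ternary_size C + 2 * r * 3 ^ C ->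
    K < 2 * r * (ternary_size C).+1 -> N <= 2 * K + C ->
  ~~ mono_copy (split_coloring K N) true (parent_graph (blown_parent C a) n).
Proof.
move=> a_gt0 r_gt0 en Klt leN; apply/negP => /mono_copyP[f finj fc].
pose g v : nat := f (inord v).
have gE (u : 'I_n.+1) : g u = f u by rewrite /g inord_val.
have lt v : 0 < v -> blown_parent C a v < v by apply: blown_parent_lt.
have edge v : 0 < v < ternary_size C + 2 * r * 3 ^ C ->
    ~~ (2 * K <= g v) -> ~~ (2 * K <= g (blown_parent C a v)) ->
    (g v < K) = (g (blown_parent C a v) < K).
  rewrite -en => /andP[v_gt0 vn].
  have hv : 0 < v <= n by rewrite v_gt0 -ltnS.
  have plt i : 0 < i <= n -> blown_parent C a i < i by case/andP => /lt.
  have := fc _ _ (parent_adjP plt hv).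
  by rewrite split_coloringE -/(g v) -/(g (blown_parent C a v)); lia.
have [||s] := blown_unbalanced a_gt0 edge; first by rewrite muln_gt0.
  rewrite -en -(card_ordE (fun v => 2 * K <= g v)).
  apply: (card_interval_preim (lo := 2 * K) finj) => x; rewrite inE gE => ->.
  by rewrite (leq_trans (ltn_ord _) leN).
rewrite -en -(card_ordE (fun v => ((g v < K) == s) && ~~ (2 * K <= g v))).
move=> /(leq_trans Klt); rewrite ltnNge => /negP; apply.
by apply: (card_interval_preim (lo := if s then 0 else K) finj) => x;
  rewrite inE gE; case: s; lia.
Qed.

(** * Choice of parameters and the final bound *)

Lemma blown_graph_spec (C r : nat) (M := ternary_size C) :
    0 < C -> 2 * M + 6 <= r ->
  exists a : nat -> nat, let T := parent_graph (blown_parent C a) (M + 2 * r * 3 ^ C).-1 in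
    [/\ forall b, b < 3 ^ C -> 0 < a b, is_tree T, max_degree T <= 7
      & has_class_sizes T ((3 ^ C + 1) * r) ((3 ^ C - 1) * r + M)].
Proof.
move=> C_gt0 hr; have em := expn3E C; rewrite -/M in em; set m := 3 ^ C in em *.
have m3 : 3 <= m by rewrite -(expn1 3) leq_pexp2l.
pose U := \sum_(v < M) (odd (ternary_level v) == odd C).
have UM : U <= M.
  rewrite -[leqRHS]card_ord -sum1_card; apply: leq_sum => v _.
  by case: (_ == _).
(* The larger class has [U] branch vertices and [r + eb b] vertices in blob [b]; spreading [e]
   evenly over the blobs makes the total [U + m * r + e = (m + 1) * r]. *)
pose e := r - U; pose eb b := e %/ m + (b < e %% m).
(* Since [r >= 6], this gives [2 * eb b <= r], hence [2 * r <= 4 * a b]. *)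
have eb_le b : 3 * eb b <= r + 3.
  have : e %/ m * 3 <= r.
    apply: leq_trans (leq_mul (leqnn _) m3) _.
    by apply: leq_trans (leq_divM e m) (leq_subr _ _).
  by rewrite /eb; case: (b < _); lia.
have sum_eb : \sum_(b < m) eb b = e.
  rewrite big_split sum_nat_const card_ord /= [RHS](divn_eq e m) mulnC; congr (_ + _).
  have : e %% m <= m by rewrite ltnW // ltn_pmod //; lia.
  move: (e %% m) => q /subnKC <-.
  rewrite (@sum_ord_add q (m - q) (fun b => b < q)).
  rewrite (eq_bigr (fun=> 1)) => [|i _]; last by rewrite ltn_ord.
  rewrite sum_nat_const card_ord muln1 big1 ?addn0 // => i _.
  by rewrite ltnNge leq_addr.
pose a b := r - eb b.
have a_gt0 b : b < m -> 0 < a b by move=> _; have := eb_le b; rewrite /a; lia.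
have hL b : b < m -> 2 * a b <= 2 * r <= 4 * a b.
  by move=> _; have := eb_le b; rewrite /a; lia.
have rm : r <= r * m by rewrite leq_pmulr //; lia.
have nE : (M + 2 * r * m).-1.+1 = M + 2 * r * m by rewrite prednK //; lia.
exists a; split=> //.
- by apply: parent_graph_tree => i /andP[i_gt0 _]; apply: blown_parent_lt.
- apply: (parent_graph_degree (ch := blown_children C a)) => i //.
  by move=> /andP[i_gt0 _]; apply: blown_in_children.
- apply: (parent_graph_classes (col := blown_color C a)).
  + move=> i hi; apply: (@blown_colorE C a a_gt0 (2 * r)) => //.
    by rewrite -/M -/m; lia.
  + rewrite nE sum_blown_color // -/M -/m -/U.
    rewrite (eq_bigr (fun b : 'I_m => r + eb b)).
      by rewrite big_split sum_nat_const card_ord /= sum_eb /e; lia.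
    by move=> b _; have := eb_le b; rewrite /a; lia.
  + by rewrite nE em; lia.
Qed.

Theorem theorem1p4 : forall C : nat, 1 <= C ->
  exists r0 : nat, forall r : nat, r0 <= r ->
  exists T S : sgraph,
    is_tree T /\ is_tree S /\
    (max_degree T <= 3 ^ C.+1 /\ max_degree S <= 3 ^ C.+1) /\
    has_class_sizes T ((3 ^ C + 1) * r) ((3 ^ C - 1) * r + (3 ^ C - 1) %/ 2) /\
    has_class_sizes S ((3 ^ C + 1) * r) (2 * r - (3 ^ C - 1) %/ 2) /\
    (2 * (3 ^ C + 1) * r + C - 1 <= ramsey T S /\
     2 * (3 ^ C + 1) * r + C - 1 = ramsey_lower T S + C).
Proof.
(* The threshold is quadratic because fitting the leaves of [S] on its comb requires
   [M * (M + 2) <= 2 * r]. *)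
move=> C C_gt0; pose M := ternary_size C; exists ((M + 3) * (M + 3)) => r hr.
have em := expn3E C; rewrite -/M in em.
have m3 : 3 <= 3 ^ C by rewrite -(expn1 3) leq_pexp2l.
have [|a] := @blown_graph_spec C r C_gt0; first by rewrite -/M; lia.
rewrite -/M; set T := parent_graph _ _ => -[a_gt0 Ttree Tdeg Tcls].
(* The smaller class must have [2 * r - M] vertices; up to [M.+1] leaves at each keep the degree
   within [M + 3 <= 3 ^ C.+1]. *)
have [|||Stree Sdeg Scls] := @comb_graph_spec M.+1 (2 * r - M) (2 * M * r + M).
- by lia.
- by lia.
- by rewrite mulnBr; lia.
set S := parent_graph _ _ in Stree Sdeg Scls.
have eS : 2 * r - M + (2 * M * r + M) = (3 ^ C + 1) * r by rewrite em; lia.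
rewrite eS in Scls; exists T, S; rewrite -[(3 ^ C - 1) %/ 2]/M.
split=> //; split=> //; split.
  by rewrite expnS; split; [apply: leq_trans Tdeg _|apply: leq_trans Sdeg _]; lia.
split=> //; split=> //.
have [cT lT sT] := tree_class_sizes Ttree Tcls ltac:(rewrite em; lia).
have [cS lS sS] := tree_class_sizes Stree Scls ltac:(rewrite em; lia).
(* All four terms of the maximum equal [2 * (3 ^ C + 1) * r]. *)
split; last by rewrite /ramsey_lower cT lT sT cS lS sS em; lia.
rewrite /ramsey; case: ex_minnP => N /andP[_ /forallP ar] _.
pose K := ((3 ^ C + 1) * r).-1; rewrite leqNgt; apply/negP => ltN.
have rpos : 0 < (3 ^ C + 1) * r by rewrite muln_gt0; lia.
have leN : N <= 2 * K + C by rewrite /K; lia.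
have := ar (split_coloring K N); apply/negP; rewrite negb_or.
rewrite (split_coloring_no_blue _ Stree Scls) ?andbT; first last.
- by lia.
- by rewrite /K prednK.
apply: (split_coloring_no_red (r := r) a_gt0) => //; first by lia.
- by rewrite prednK -/M; lia.
- by rewrite /K -/M prednK // em; lia.
Qed.
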